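(* Let $q$ be a prime power and let $C$ be a self-dual completely regular $[n,k,d]_q$ code. If $d\le 2$, then $C$ is necessarily an MDS $[2,1,2]_q$ code, or a direct sum of $j$ codes with these parameters (and $C$ is not MDS for $j>1$). Such codes exist if and only if $q$ is even or $q\equiv 1 \pmod 4$.
   Context: $\mathbb{F}_q$ is the finite field of order $q$. An $[n,k,d]_q$ code $C$ is a $k$-dimensional linear subspace of $\mathbb{F}_q^n$ with minimum Hamming distance $d$; it is assumed that $0<k<n$. The dual is $C^\perp=\{\mathbf{x}\in\mathbb{F}_q^n : \mathbf{x}\cdot\mathbf{v}=0\ \forall \mathbf{v}\in C\}$ with respect to the Euclidean inner product $\mathbf{v}\cdot\mathbf{u}=\sum_{i=1}^n v_iu_i$, and $C$ is self-dual if $C=C^\perp$. For $\mathbf{v}\in\mathbb{F}_q^n$, $d(\mathbf{v},C)=\min\{d(\mathbf{v},\mathbf{x}) : \mathbf{x}\in C\}$ (Hamming distance), and for $t\in\{0,\dots,n\}$, $B_{\mathbf{v},t}=|\{\mathbf{x}\in C : d(\mathbf{v},\mathbf{x})=t\}|$. $C$ is completely regular if $B_{\mathbf{v},t}$ depends only on $t$ and $d(\mathbf{v},C)$. $C$ is MDS (maximum distance separable) if $d=n-k+1$. *)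

(* Defs.v *)
From HB Require Import structures.
From mathcomp Require Import all_boot all_order all_algebra.

Set Implicit Arguments.
Unset Strict Implicit.
Unset Printing Implicit Defensive.

Import GRing.Theory.
Local Open Scope ring_scope.

Section Codes.

Variables (F : finFieldType) (n : nat).
Implicit Types (C : {vspace 'rV[F]_n}) (x v u : 'rV[F]_n).

Definition dotp v u : F := \sum_(i < n) v 0 i * u 0 i.

Definition hdist v u : nat := #|[set i | v 0 i != u 0 i]|.

Definition dual_code C : {set 'rV[F]_n} :=
  [set x | [forall v in C, dotp x v == 0]].

Definition self_dual C : Prop := [set x in C] = dual_code C.

(* In both minima below the default value n is harmless: hdist never exceeds
   n, so n can only be the result of the fold if it is the true minimum or if
   the range is empty. The latter happens only for min_dist of the zero code,
   which is_code excludes. *)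
Definition min_dist C : nat :=
  \big[minn/n]_(p : 'rV[F]_n * 'rV[F]_n
                | [&& p.1 \in C, p.2 \in C & p.1 != p.2]) hdist p.1 p.2.

Definition dist_code v C : nat := \big[minn/n]_(x in C) hdist v x.

(* C is an [n, k, d] code over F; the length n is carried by the type of C. *)
Definition is_code k d C : Prop :=
  [/\ (0 < k < n)%N, \dim C = k & min_dist C = d].

Definition Bnum C v (t : nat) : nat := #|[set x in C | hdist v x == t]|.

Definition completely_regular C : Prop :=
  forall v u (t : nat), (t <= n)%N ->
    dist_code v C = dist_code u C -> Bnum C v t = Bnum C u t.

Definition is_mds C : Prop := min_dist C = (n - \dim C + 1)%N.

(* C is the direct sum of the codes D 0, ..., D (j - 1) of length m, that is,
   the set of all concatenations (c_0 | ... | c_(j-1)) with c_i \in D i, up to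
   the order of the coordinates: f (i, b) is the position in C of the b-th
   coordinate of the i-th block. *)
Definition is_direct_sum (j m : nat) (D : 'I_j -> {vspace 'rV[F]_m}) C : Prop :=
  exists2 f : 'I_j * 'I_m -> 'I_n, bijective f &
    forall x, x \in C <-> forall i, \row_(b < m) x 0 (f (i, b)) \in D i.

End Codes.

Definition sum_of_212 (F : finFieldType) (n j : nat)
    (C : {vspace 'rV[F]_n}) : Prop :=
  exists2 D : 'I_j -> {vspace 'rV[F]_2},
    forall i, is_code 1 2 (D i) & is_direct_sum D C.

(* Main.v *)
Require Import Defs.
From HB Require Import structures.
From mathcomp Require Import all_boot all_order all_algebra.
From mathcomp Require Import all_fingroup all_solvable all_field zify ring.

Set Implicit Arguments.
Unset Strict Implicit.
Unset Printing Implicit Defensive.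

Import GRing.Theory.

(** A self-dual code has no word of weight 1, since such a word is not
orthogonal to itself; so a self-dual code C with d <= 2 has d = 2. Write e_i
for the unit vectors. A weight-2 word of C is, up to a scalar, e_i + c e_j,
and self-orthogonality reads c^2 = -1.

Complete regularity spreads such words over all coordinates. Every e_i is at
distance 1 from C, hence the number of codewords at distance 1 from e_i is
the same for all i. These codewords are 0 and the words e_i + c e_j of C
([near_delta]), so the existence of a single weight-2 word forces every i to
have a partner j = s(i) with e_i + c_i e_j in C ([pair_word_everywhere]).
Orthogonality of two such words makes s a fixed-point-free involution
([partner_involution]), whose orbits cut the coordinates into blocks of size
2. Duality then leaves only one possibility for C: the set of all x with
x_s(i) = c_i x_i on each block ([self_dual_paired]), which is the direct sum
of the lines spanned by (1, c_i), each a [2, 1, 2] code.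

Conversely let c^2 = -1 and let C be the direct sum of j copies of the line
spanned by (1, c). It is self-dual, and its complete regularity is read off a
generating polynomial ([completely_regular_blocks]): the sum of
X^(hdist v x) over x in C is a product over the blocks, and each factor takes
one of two values, according to whether the restriction of v to the block is
on the line. The number of blocks where it is not is the distance of v to C
([dist_code_syndrome]).

So the codes exist if and only if -1 is a square in F, which is the stated
condition on q ([card_of_sqrtN1], [sqrtN1_of_card]). *)

(** * Minima and square roots of -1 *)

Lemma bigminn_le (I : finType) (P : pred I) (h : I -> nat) m i :
  P i -> \big[minn/m]_(i | P i) h i <= h i.
Proof.
by move=> Pi; exact: (@Order.TotalTheory.bigmin_le_cond _ nat I m i P h Pi).
Qed.

Section SquareRoots.
Local Open Scope ring_scope.
Variable F : finFieldType.

Lemma sqrtN1_neq0 (c : F) : c ^+ 2 = -1 -> c != 0.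
Proof.
move=> c2; apply: contra_eq_neq c2 => ->.
by rewrite expr0n eq_sym oppr_eq0 oner_eq0.
Qed.

(** If q = 3 mod 4, then c = c^q = c^3 = -c because c^4 = 1, so 2c = 0; but
c is nonzero, and 2 is nonzero in F for odd q. *)
Lemma card_of_sqrtN1 (c : F) :
  c ^+ 2 = -1 -> (~~ odd #|F| \/ #|F| = 1 %[mod 4])%N.
Proof.
move=> c2; case oddq: (odd #|F|); [right | by left].
(* the order of 1 in the additive group of F divides q *)
have q1 : #|F|%:R = 0 :> F.
  by rewrite -FinRing.zmodXgE -cardsT expg_cardG ?inE.
have n2 : (2%:R : F) != 0.
  apply: contra_eq_neq q1 => e2; rewrite -(odd_double_half #|F|) oddq.
  by rewrite natrD -muln2 natrM e2 mulr0 addr0 oner_eq0.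
case: (eqVneq (#|F| %% 4)%N 1%N) => [-> //|ne1].
have e3 : (#|F| = (#|F| %/ 4) * 4 + 3)%N by lia.
have := expf_card c; rewrite e3 exprD mulnC exprM.
have -> : c ^+ 4 = 1 by rewrite (exprM c 2 2) c2 sqrrN expr1n.
rewrite expr1n mul1r exprSr c2 mulN1r => /eqP; rewrite eq_sym -addr_eq0.
rewrite -mulr2n -mulr_natr mulf_eq0 (negPf n2) orbF.
by rewrite (negPf (sqrtN1_neq0 c2)).
Qed.

(** For even q, the exponent q - 1 is odd and (-1)^(q-1) = 1, so -1 = 1 = 1^2.
For q = 4m + 1, the equation x^(2m) = 1 has at most 2m < q - 1 solutions; any
other nonzero x has x^(2m) = -1, and x^m is the required square root. *)
Lemma sqrtN1_of_card :
  (~~ odd #|F| \/ #|F| = 1 %[mod 4])%N -> exists c : F, c ^+ 2 = -1.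
Proof.
have Fgt1 : (1 < #|F|)%N by exact: finNzRing_gt1.
have unit_exp (x : F) : x != 0 -> x ^+ #|F|.-1 = 1.
  move=> x0; apply: (mulIf x0); rewrite mul1r -exprSr prednK ?expf_card //.
  exact: ltnW.
case=> [evq | q1].
  have := unit_exp (-1); rewrite oppr_eq0 oner_eq0 -signr_odd => /(_ isT).
  rewrite -subn1 oddB ?(ltnW Fgt1) // (negPf evq) => e.
  by exists 1; rewrite expr1n -[LHS]e.
have [m [m0 q4]] : exists m, (0 < m /\ #|F| = (4 * m).+1)%N.
  by exists (#|F| %/ 4)%N; lia.
pose rs := [seq x <- enum F | (2 * m).-unity_root x].
have rs_small : (size rs <= 2 * m)%N.
  apply: max_unity_roots; rewrite ?filter_all ?filter_uniq ?muln_gt0 //.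
  by rewrite -enumT enum_uniq.
have [x /andP[x0 nx]] : exists x : F, (x != 0) && ~~ (2 * m).-unity_root x.
  apply/existsP; apply: contraT; rewrite negb_exists => /forallP allr.
  have : (#|[set~ (0%R : F)]| <= size rs)%N.
    rewrite cardE; apply: uniq_leq_size; rewrite ?enum_uniq // => x.
    rewrite mem_enum !inE => x0; rewrite mem_filter mem_enum andbT.
    by have := allr x; rewrite x0 negbK.
  by rewrite cardsC1 q4 => /leq_trans/(_ rs_small); clear -m0; lia.
exists (x ^+ m); rewrite -exprM mulnC.
have : (x ^+ (2 * m)) ^+ 2 = 1.
  by rewrite -exprM -(unit_exp x x0) q4 /=; congr (x ^+ _); lia.
by move/eqP; rewrite sqrf_eq1 -unity_rootE (negPf nx) => /eqP.
Qed.

End SquareRoots.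

(** * Words of small weight in self-orthogonal codes *)

Section Codes.
Local Open Scope ring_scope.
Variables (F : finFieldType) (n : nat).
Implicit Types (C : {vspace 'rV[F]_n}) (x y v : 'rV[F]_n).

(** Makes the bilinearity lemmas of the matrix product available for dotp. *)
Lemma dotp_mx x y : dotp x y = (x *m y^T) 0 0.
Proof. by rewrite mxE; apply: eq_bigr => i _; rewrite mxE. Qed.

(** Up to scalars these are the only words of weight 2. *)
Definition pair_word (i j : 'I_n) (c : F) : 'rV[F]_n :=
  delta_mx 0 i + c *: delta_mx 0 j.

Lemma pair_wordE i j c k :
  pair_word i j c 0 k = (k == i)%:R + c * (k == j)%:R.
Proof. by rewrite !mxE eqxx. Qed.

Lemma dotp_pair_word i j c y : dotp (pair_word i j c) y = y 0 i + c * y 0 j.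
Proof. by rewrite dotp_mx mulmxDl -scalemxAl -!rowE !mxE. Qed.

Lemma hdist_sub x y : hdist x y = hdist (x - y) 0.
Proof. by apply: eq_card => i; rewrite !inE !mxE subr_eq0. Qed.

Lemma hdist_eq0 x y : (hdist x y == 0%N) = (x == y).
Proof.
rewrite cards_eq0; apply/eqP/eqP => [e | ->].
  apply/rowP => i; apply/eqP; have := in_set0 i.
  by rewrite -e inE => /negbFE.
by apply/setP => i; rewrite !inE eqxx.
Qed.

Lemma hdist_max x y : (hdist x y <= n)%N.
Proof. by rewrite -[leqRHS]card_ord max_card. Qed.

Lemma self_dualP C x :
  self_dual C -> x \in C <-> forall y, y \in C -> dotp x y = 0.
Proof.
move=> sd; have -> : (x \in C) = (x \in dual_code C) by rewrite -sd inE.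
rewrite inE; split=> [/forall_inP h y yC | h]; first exact/eqP/h.
by apply/forall_inP => y yC; apply/eqP/h.
Qed.

Lemma self_dual_orth C x y :
  self_dual C -> x \in C -> y \in C -> dotp x y = 0.
Proof. by move=> sd /(self_dualP x sd) h /h. Qed.

Lemma wt1_nonisotropic x : hdist x 0 = 1%N -> dotp x x != 0.
Proof.
move=> /eqP/cards1P[i si].
have xk k : (x 0 k != 0) = (k == i).
  by have /setP/(_ k) := si; rewrite !inE mxE.
rewrite /dotp (bigD1 i) //= big1 => [|k ki].
  by rewrite addr0 mulf_eq0 orbb xk.
by have := xk k; rewrite (negPf ki) => /negbFE/eqP->; rewrite mul0r.
Qed.

(** An isotropic word cannot have weight 1, so its support is a pair {i, j} and
it is normalised by its value at i. *)
Lemma wt_le2 x :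
  x != 0 -> dotp x x = 0 -> (hdist x 0 <= 2)%N ->
  exists i j c, [/\ i != j, x 0 i != 0 & x = x 0 i *: pair_word i j c].
Proof.
move=> x0 iso le2.
have w2 : hdist x 0 = 2%N.
  have : hdist x 0 != 0%N by rewrite hdist_eq0.
  have : hdist x 0 != 1%N.
    by apply/eqP => /wt1_nonisotropic; rewrite iso eqxx.
  by lia.
have /cards2P[i [j [ij sij]]] := introT eqP w2.
have xk k : (x 0 k != 0) = (k == i) || (k == j).
  by have /setP/(_ k) := sij; rewrite !inE mxE.
have xi : x 0 i != 0 by rewrite xk eqxx.
exists i, j, (x 0 j / x 0 i); split=> //; apply/rowP => k.
rewrite mxE pair_wordE mulrDr mulrA [_ * (_ / _)]mulrC divfK //.
case: (eqVneq k i) => [-> | ki].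
  by rewrite (negPf ij) mulr1 mulr0 addr0.
case: (eqVneq k j) => [-> | kj]; first by rewrite mulr0 mulr1 add0r.
by have := xk k; rewrite (negPf ki) (negPf kj) !mulr0 addr0 => /negbFE/eqP.
Qed.

Lemma min_dist_ge2 C :
  (1 < n)%N -> (forall x, x \in C -> dotp x x = 0) -> (1 < min_dist C)%N.
Proof.
move=> n1 iso; rewrite /min_dist.
elim/big_ind: _ => // [a b a1 b1|[x y] /and3P[/= xC yC xy]].
  by rewrite leq_min a1.
rewrite hdist_sub.
have : hdist (x - y) 0 != 0%N by rewrite hdist_eq0 subr_eq0.
have : hdist (x - y) 0 != 1%N.
  by apply/eqP => /wt1_nonisotropic; rewrite iso ?eqxx // rpredB.
by case: (hdist _ _) => [|[]].
Qed.

Lemma min_dist_le_wt C x : x \in C -> x != 0 -> (min_dist C <= hdist x 0)%N.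
Proof.
move=> xC x0; rewrite /min_dist.
by apply: (@bigminn_le _ _ _ _ (x, 0)); rewrite /= xC mem0v x0.
Qed.

Lemma min_dist_attained C :
  (0 < \dim C)%N -> exists2 x, x \in C & x != 0 /\ (hdist x 0 <= min_dist C)%N.
Proof.
rewrite lt0n dimv_eq0 -vpick0 => C0; rewrite /min_dist.
elim/big_ind: _ => [|a b ha hb|[x y] /and3P[/= xC yC xy]].
- by exists (vpick C); rewrite ?memv_pick ?hdist_max.
- by rewrite /minn; case: ifP.
exists (x - y); first by rewrite rpredB.
by rewrite subr_eq0 /= -hdist_sub.
Qed.

Lemma pair_word_in C :
  (0 < \dim C)%N -> self_dual C -> (min_dist C <= 2)%N ->
  exists i j c, i != j /\ pair_word i j c \in C.
Proof.
move=> k0 sd d2; have [x xC [x0 /leq_trans/(_ d2) w2]] := min_dist_attained k0.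
have [i [j [c [ij xi xE]]]] := wt_le2 x0 (self_dual_orth sd xC xC) w2.
by exists i, j, c; split=> //; move: xC; rewrite xE rpredZeq (negPf xi).
Qed.

Lemma pair_word_sqr C i j c :
  self_dual C -> i != j -> pair_word i j c \in C -> c ^+ 2 = -1.
Proof.
move=> sd ij pC; have := self_dual_orth sd pC pC.
rewrite dotp_pair_word !pair_wordE !eqxx (negPf ij) eq_sym (negPf ij).
move=> /= e; apply/eqP; rewrite -addr_eq0 addrC; apply/eqP.
by rewrite -e; ring.
Qed.

End Codes.

(** * Lines in the plane and their direct sums *)

Section Lines.
Local Open Scope ring_scope.
Variables (F : finFieldType) (c : F).

Definition line : {vspace 'rV[F]_2} := <[pair_word ord0 ord_max c]>%VS.

(** In the plane, pair_word ord0 ord_max c is the vector (1, c). *)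
Lemma mem_line (y : 'rV[F]_2) :
  (y \in line) = (y 0 ord_max == c * y 0 ord0).
Proof.
apply/vlineP/eqP => [[a ->] | e].
  by rewrite [LHS]mxE [in RHS]mxE !pair_wordE /=; ring.
exists (y 0 ord0); apply/rowP => k; rewrite mxE pair_wordE.
case: k => [[|[|//]] lek] /=.
  rewrite (_ : Ordinal lek = ord0); last exact: val_inj.
  by rewrite /=; ring.
by rewrite (_ : Ordinal lek = ord_max) ?e; [rewrite /=; ring | exact: val_inj].
Qed.

(** The line spanned by (1, c) is isotropic, as 1 + c^2 = 0, which excludes
distance 1; its length is 2, which excludes any distance above 2. *)
Lemma line_is_code : c ^+ 2 = -1 -> is_code 1 2 line.
Proof.
move=> c2; rewrite /line; set w := pair_word _ _ _.
have w0 : w != 0.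
  apply/eqP => /rowP/(_ ord0); rewrite pair_wordE mxE /= mulr0 addr0.
  by move/eqP; rewrite oner_eq0.
split=> //; first by rewrite dim_vline w0.
apply/eqP; rewrite eqn_leq; apply/andP; split.
  exact: leq_trans (min_dist_le_wt (memv_line w) w0) (hdist_max _ _).
apply: min_dist_ge2 => // y; rewrite -/line mem_line => /eqP e.
rewrite /dotp big_ord_recr big_ord1 /=.
rewrite (_ : widen_ord _ _ = ord0); last exact: val_inj.
rewrite e -[RHS](mulr0 (y 0 ord0 * y 0 ord0)) -(addrN 1) -[- 1]c2; ring.
Qed.

End Lines.

Section Blocks.
Local Open Scope ring_scope.
Variables (F : finFieldType) (n j : nat) (f : 'I_j * 'I_2 -> 'I_n).
Hypothesis f_bij : bijective f.
Variable c : 'I_j -> F.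
Hypothesis c2 : forall i, c i ^+ 2 = -1.
Implicit Types (x y : 'rV[F]_n) (C : {vspace 'rV[F]_n}).

(** Words whose restriction to every block f (i, _) is a multiple of (1, c_i);
the bijection f lists the two coordinates of each block. *)
Definition paired x :=
  forall i, x 0 (f (i, ord_max)) = c i * x 0 (f (i, ord0)).

Lemma length_blocks : n = (j * 2)%N.
Proof. by have := bij_eq_card f_bij; rewrite card_prod !card_ord. Qed.

Lemma big_blocks (R : Type) (idx : R) (op : Monoid.com_law idx) h :
  \big[op/idx]_k h k =
  \big[op/idx]_i op (h (f (i, ord0))) (h (f (i, ord_max))).
Proof.
rewrite (reindex f) /=; last exact: onW_bij.
rewrite (eq_bigr (fun p => h (f (p.1, p.2)))) => [|[] //].
rewrite -(pair_bigA _ (fun i b => h (f (i, b)))) /=; apply: eq_bigr => i _.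
rewrite big_ord_recr big_ord1 /=.
by congr (op (h (f (i, _))) _); apply: val_inj.
Qed.

(** Each block contributes x_i y_i (1 + c_i^2) = 0. *)
Lemma paired_orth x y : paired x -> paired y -> dotp x y = 0.
Proof.
move=> px py; rewrite /dotp big_blocks big1 // => i _ /=.
rewrite px py.
by rewrite -[RHS](mulr0 (x 0 (f (i, ord0)) * y 0 (f (i, ord0)))) -(addrN 1)
  -[- 1](c2 i); ring.
Qed.

Lemma paired_pair_word i :
  paired (pair_word (f (i, ord0)) (f (i, ord_max)) (c i)).
Proof.
move=> k; rewrite !pair_wordE !(bij_eq f_bij) !xpair_eqE eqxx /= !andbF !andbT.
by rewrite mulr0 addr0 add0r; case: eqP => [->|_] //; rewrite !mulr0.
Qed.

(** Since -1 / c_i = c_i, the relation x_i + c_i x_s(i) = 0 between the two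
coordinates of a block is the same as x_s(i) = c_i x_i. *)
Lemma pairedP x :
  paired x <-> forall i,
    dotp (pair_word (f (i, ord0)) (f (i, ord_max)) (c i)) x = 0.
Proof.
split=> [px i | orth i]; first exact/paired_orth/px/paired_pair_word.
have := orth i; rewrite dotp_pair_word => /eqP; rewrite addr_eq0 => /eqP ->.
by rewrite mulrN mulrA -expr2 c2 mulN1r opprK.
Qed.

Lemma paired_self_dual C : (forall x, x \in C <-> paired x) -> self_dual C.
Proof.
move=> CP; apply/setP => x; rewrite !inE; apply/idP/forall_inP => [|orth].
  by move=> /CP px y /CP py; rewrite paired_orth.
apply/CP/pairedP => i; rewrite /dotp; under eq_bigr do rewrite mulrC.
by apply/eqP/orth/CP/paired_pair_word.
Qed.

(** C consists of paired words because it is orthogonal to its own words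
pair_word, and contains them all because paired words are orthogonal to each
other. *)
Lemma self_dual_paired C :
  self_dual C ->
  (forall i, pair_word (f (i, ord0)) (f (i, ord_max)) (c i) \in C) ->
  forall x, x \in C <-> paired x.
Proof.
move=> sd wC.
have sub x : x \in C -> paired x.
  by move=> xC; apply/pairedP => i; exact: self_dual_orth sd (wC i) xC.
move=> x; split=> [/sub //|px].
by apply/(self_dualP x sd) => y /sub py; exact: paired_orth.
Qed.

Lemma paired_sum_of_212 C : (forall x, x \in C <-> paired x) -> sum_of_212 j C.
Proof.
move=> CP; exists (fun i => line (c i)).
  by move=> i; exact: line_is_code.
exists f => // x; split.
  by move=> /CP px i; rewrite mem_line !mxE px.
move=> h; apply/CP => i; have := h i; rewrite mem_line !mxE.
by move/eqP.
Qed.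

(** A paired word is determined by the first coordinate of each block. *)
Lemma dim_paired C : (forall x, x \in C -> paired x) -> (\dim C <= j)%N.
Proof.
move=> CP.
pose p := linfun (colsub (fun i : 'I_j => f (i, ord0)) : 'rV[F]_n -> 'rV[F]_j).
have injp : (C :&: lker p)%VS = 0%VS.
  apply/eqP; rewrite -subv0; apply/subvP => x; rewrite memv_cap memv_ker.
  case/andP => /CP px /eqP; rewrite lfunE /= => /rowP x0.
  have {}x0 i : x 0 (f (i, ord0)) = 0 by have := x0 i; rewrite !mxE.
  rewrite memv0; apply/eqP/rowP => k; rewrite mxE.
  have [g _ gK] := f_bij; rewrite -(gK k).
  case: (g k) => i [[|[|//]] lek].
    by rewrite (_ : Ordinal lek = ord0); last exact: val_inj.
  rewrite (_ : Ordinal lek = ord_max); last exact: val_inj.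
  by rewrite px x0 mulr0.
rewrite -(limg_dim_eq injp); apply: leq_trans (dimvS (subvf _)) _.
by rewrite dimvf dim_matrix mul1r.
Qed.

(** The length is n = 2j, so n - \dim C + 1 >= j + 1 > 2. *)
Lemma paired_not_mds C :
  (forall x, x \in C -> paired x) -> (min_dist C <= 2)%N -> (1 < j)%N ->
  ~ is_mds C.
Proof.
move=> /dim_paired dC d2 j1; rewrite /is_mds => e.
have := length_blocks; rewrite e in d2; clear -dC d2 j1; lia.
Qed.

Lemma hdist_blocks x y :
  hdist x y = (\sum_i ((x 0%R (f (i, ord0)) != y 0%R (f (i, ord0))) +
   (x 0%R (f (i, ord_max)) != y 0%R (f (i, ord_max)))))%N.
Proof.
rewrite /hdist -sum1dep_card big_mkcond big_blocks /=.
by apply: eq_bigr => i _; case: eqP; case: eqP.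
Qed.

End Blocks.

(** * Self-dual completely regular codes of distance 2 *)

(** The representative of an orbit {i, s i} is its smaller element, so r
enumerates the i with i < s i. *)
Lemma involution_blocks n (s : 'I_n -> 'I_n) :
  involutive s -> (forall i, i != s i) ->
  exists j (r : 'I_j -> 'I_n),
    bijective (fun p : 'I_j * 'I_2 => if p.2 == ord0 then r p.1 else s (r p.1)).
Proof.
move=> sK s_neq; pose R := [set i : 'I_n | i < s i].
exists #|R|, enum_val; set f := (fun p => _).
have rR (i : 'I_#|R|) : enum_val i < s (enum_val i).
  by have := enum_valP i; rewrite inE.
have cross (a b : 'I_#|R|) : enum_val a = s (enum_val b) -> False.
  by move=> e; have := rR a; have := rR b; rewrite e sK; lia.
(* R may be empty, so the inverse of f comes from finite choice instead of a
   formula with a default element *)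
have surj k : exists p, f p = k.
  case: (ltnP k (s k)) => [kR | skk].
    have {}kR : k \in R by rewrite inE.
    by exists (enum_rank_in kR k, ord0); rewrite /f /= enum_rankK_in.
  have kR : s k \in R by rewrite inE sK ltn_neqAle skk eq_sym s_neq.
  by exists (enum_rank_in kR (s k), ord_max); rewrite /f /= enum_rankK_in.
have [g gK] := fin_all_exists surj.
have f_inj : injective f.
  have ord2 (b b' : 'I_2) : (b == ord0) = (b' == ord0) -> b = b'.
    by case: b b' => [[|[|//]] ?] [[|[|//]] ?] // _; apply: val_inj.
  move=> [a b] [a' b']; rewrite /f /=.
  case b0: (b == ord0); case b0': (b' == ord0).
  - by move/enum_val_inj->; rewrite (ord2 b b') // b0 b0'.
  - by move/cross.
  - by move/esym/cross.
  - by move/(can_inj sK)/enum_val_inj->; rewrite (ord2 b b') // b0 b0'.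
exact: Bijective (inj_can_sym gK f_inj) gK.
Qed.

Section Classification.
Local Open Scope ring_scope.
Variables (F : finFieldType) (n : nat) (C : {vspace 'rV[F]_n}).
Hypothesis sdC : self_dual C.

Lemma hdist_delta0 (i : 'I_n) : hdist (delta_mx 0 i : 'rV[F]_n) 0 = 1%N.
Proof.
rewrite -[RHS](cards1 i); apply: eq_card => k.
by rewrite !inE !mxE /=; case: (k == i); rewrite ?oner_eq0 ?eqxx.
Qed.

(** The value is positive because e_i is not isotropic, hence not in C. *)
Lemma dist_code_delta (i : 'I_n) : dist_code (delta_mx 0 i) C = 1%N.
Proof.
apply/eqP; rewrite eqn_leq -[X in (_ <= X)%N && _](hdist_delta0 i).
rewrite bigminn_le ?mem0v //= /dist_code.
elim/big_ind: _ => [|a b a0 b0|x xC]; first exact: leq_ltn_trans (ltn_ord i).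
  by rewrite leq_min a0.
rewrite lt0n hdist_eq0; apply/eqP => e.
have := wt1_nonisotropic (hdist_delta0 i).
by rewrite e (self_dual_orth sdC xC xC) eqxx.
Qed.

(** The word x - e_i has weight 1. If it were supported at i, then x would have
weight 1, which is impossible in C. *)
Lemma near_delta (i : 'I_n) x :
  x \in C -> x != 0 -> hdist (delta_mx 0 i) x = 1%N ->
  exists j c, i != j /\ x = pair_word i j c.
Proof.
move=> xC x0 /eqP/cards1P[j sj].
have xk k : ((k == i)%:R != x 0 k) = (k == j).
  by have /setP/(_ k) := sj; rewrite !inE mxE eqxx.
case: (eqVneq i j) => [ij | ij].
  suff /wt1_nonisotropic : hdist x 0 = 1%N.
    by rewrite (self_dual_orth sdC xC xC) eqxx.
  apply/eqP; rewrite eqn_leq lt0n hdist_eq0 x0 andbT.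
  rewrite -[leqRHS](cards1 i); apply/subset_leq_card/subsetP => k.
  rewrite !inE mxE; apply: contraR => ki.
  by have := xk k; rewrite -ij (negPf ki) eq_sym => /negbFE.
exists j, (x 0 j); split=> //; apply/rowP => k; rewrite pair_wordE.
have := xk k; case: (eqVneq k j) => [-> _ | _ /negbFE/eqP <-].
  by rewrite eq_sym (negPf ij) add0r mulr1.
by rewrite mulr0 addr0.
Qed.

Lemma hdist_delta_pair_word (i j : 'I_n) (c : F) :
  c != 0 -> hdist (delta_mx 0 i) (pair_word i j c) = 1%N.
Proof.
move=> c0; rewrite -[RHS](cards1 j); apply: eq_card => k.
rewrite !inE pair_wordE mxE eqxx /= -subr_eq0 opprD addNKr oppr_eq0.
by case: (k == j); rewrite ?mulr1 ?mulr0 ?eqxx.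
Qed.

(** The unit vectors are all at distance 1 from C, so complete regularity gives
them equally many codewords at distance 1. A word e_i0 + c e_j0 of C
and 0 are two of them near e_i0; hence a nonzero one is near e_i too. *)
Lemma pair_word_everywhere :
  completely_regular C -> (0 < \dim C)%N -> (min_dist C <= 2)%N ->
  forall i, exists j c, i != j /\ pair_word i j c \in C.
Proof.
move=> crC k0 d2 i.
have [i0 [j0 [c0 [ij0 wC]]]] := pair_word_in k0 sdC d2.
have B0 : (1 < Bnum C (delta_mx 0%R i0) 1)%N.
  have w0 : 0 != pair_word i0 j0 c0.
    apply/eqP => /rowP/(_ i0); rewrite pair_wordE mxE eqxx (negPf ij0) mulr0.
    by move/eqP; rewrite addr0 eq_sym oner_eq0.
  rewrite /Bnum; have := cards2 0 (pair_word i0 j0 c0); rewrite w0 => <-.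
  apply/subset_leq_card/subsetP => x; rewrite !inE => /orP[] /eqP ->.
    by rewrite mem0v hdist_delta0.
  by rewrite wC hdist_delta_pair_word ?(sqrtN1_neq0 (pair_word_sqr sdC ij0 wC)).
have : (1 < Bnum C (delta_mx 0%R i) 1)%N.
  rewrite (crC _ (delta_mx 0 i0)) ?dist_code_delta //.
  exact: leq_trans (ltn_ord i).
have found x : x != 0 -> x \in [set x in C | hdist (delta_mx 0 i) x == 1%N] ->
    exists j c, i != j /\ pair_word i j c \in C.
  rewrite inE => x0 /andP[xC /eqP /(near_delta xC x0)[j [c [ij xE]]]].
  by exists j, c; rewrite -xE.
case/card_gt1P => x [y [xB yB xy]].
case: (eqVneq x 0) => [x0 | /found]; last exact.
by apply: (found y) => //; rewrite -x0 eq_sym.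
Qed.

(** If s (s i) <> i, then e_i + c_i e_(s i) and e_(s i) + c_(s i) e_(s (s i))
meet only at s i and have inner product c_i, which is nonzero. *)
Lemma partner_involution (s : 'I_n -> 'I_n) (c : 'I_n -> F) :
  (forall i, i != s i /\ pair_word i (s i) (c i) \in C) -> involutive s.
Proof.
move=> sP i; have [si wi] := sP i; have [ssi wsi] := sP (s i).
have := self_dual_orth sdC wi wsi; rewrite dotp_pair_word !pair_wordE eqxx.
rewrite (negPf si) (negPf ssi) mulr0 addr0 mulr1 add0r; case: eqVneq => // _.
rewrite mulr0 add0r => ci0; have := sqrtN1_neq0 (pair_word_sqr sdC si wi).
by rewrite ci0 eqxx.
Qed.

Lemma block_structure :
  completely_regular C -> (0 < \dim C)%N ->
  (min_dist C <= 2)%N ->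
  exists j (f : 'I_j * 'I_2 -> 'I_n) (c : 'I_j -> F),
    [/\ bijective f, forall i, c i ^+ 2 = -1 &
        forall x, x \in C <-> paired f c x].
Proof.
move=> cr k0 d2.
have word i : exists p : 'I_n * F, i != p.1 /\ pair_word i p.1 p.2 \in C.
  have [j [c jc]] := pair_word_everywhere cr k0 d2 i.
  by exists (j, c).
have [p pP] := fin_all_exists word.
pose s i := (p i).1; pose c i := (p i).2.
have sK : involutive s by exact: (partner_involution pP).
have [j [r f_bij]] := involution_blocks sK (fun i => (pP i).1).
have c2 i : c i ^+ 2 = -1.
  by have [si wi] := pP i; exact: pair_word_sqr sdC si wi.
exists j, (fun q => if q.2 == ord0 then r q.1 else s (r q.1)), (c \o r).
split=> // [i|x]; first exact: c2.
by apply: self_dual_paired => // i; [exact: c2 | exact: (pP (r i)).2].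
Qed.

End Classification.

(** * Complete regularity of the direct sums *)

Section Regularity.
Local Open Scope ring_scope.
Variables (F : finFieldType) (n j : nat).
Variables (f : 'I_j * 'I_2 -> 'I_n) (g : 'I_n -> 'I_j * 'I_2).
Hypotheses (fK : cancel f g) (gK : cancel g f).
Variable c : F.
Variable C : {vspace 'rV[F]_n}.
Hypothesis CP : forall x, x \in C <-> paired f (fun=> c) x.
Implicit Types (x y v : 'rV[F]_n) (a : {ffun 'I_j -> F}).

(** Parametrises C by the first coordinates of the blocks. *)
Definition word a : 'rV[F]_n :=
  \row_k (if (g k).2 == ord0 then a (g k).1 else c * a (g k).1).

Lemma word0 a i : word a 0 (f (i, ord0)) = a i.
Proof. by rewrite mxE fK. Qed.

Lemma word1 a i : word a 0 (f (i, ord_max)) = c * a i.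
Proof. by rewrite mxE fK. Qed.

Lemma word_inj : injective word.
Proof. by move=> a b e; apply/ffunP => i; rewrite -word0 e word0. Qed.

Lemma word_in a : word a \in C.
Proof. by apply/CP => i; rewrite word0 word1. Qed.

Lemma in_word x : x \in C -> x = word [ffun i => x 0 (f (i, ord0))].
Proof.
move=> /CP px; apply/rowP => k; rewrite mxE ffunE -{1}(gK k).
case: (g k) => i [[|[|//]] lek].
  by rewrite (_ : Ordinal lek = ord0); last exact: val_inj.
by rewrite (_ : Ordinal lek = ord_max) ?px //; exact: val_inj.
Qed.

(** Vanishes exactly when the restriction of v to block i lies on the line
spanned by (1, c). *)
Definition syndrome v i : F := v 0 (f (i, ord_max)) - c * v 0 (f (i, ord0)).

(** In a block, subtracting from v the word of the code with the same first
coordinate leaves (0, syndrome v i). *)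
Lemma hdist_word v a :
  hdist v (word a) =
  (\sum_i (((a i - v 0 (f (i, ord0)))%R != 0%R) +
           (syndrome v i != c * (a i - v 0 (f (i, ord0))))%R))%N.
Proof.
rewrite (hdist_blocks (Bijective fK gK)); apply: eq_bigr => i _.
rewrite word0 word1 subr_eq0 eq_sym /syndrome; congr (_ + ~~ _)%N.
by rewrite -subr_eq0 -[RHS]subr_eq0; congr (_ == 0); ring.
Qed.

(** A codeword must differ from v in each block with nonzero syndrome, and the
codeword with the same first coordinates as v differs nowhere else. *)
Lemma dist_code_syndrome v : dist_code v C = #|[pred i | syndrome v i != 0]|.
Proof.
have le_n : (#|[pred i | syndrome v i != 0%R]| <= n)%N.
  rewrite (length_blocks (Bijective fK gK)); apply: leq_trans (max_card _) _.
  by rewrite card_ord leq_pmulr.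
apply/eqP; rewrite eqn_leq; apply/andP; split.
  apply: leq_trans (bigminn_le _ _ (word_in [ffun i => v 0 (f (i, ord0))])) _.
  rewrite hdist_word -sum1_card [leqRHS]big_mkcond /=; apply: leq_sum => i _.
  by rewrite ffunE subrr mulr0 eqxx /= inE; case: eqP.
rewrite /dist_code; elim/big_ind: _ => // [a b la lb|x /in_word ->].
  by rewrite leq_min la.
rewrite hdist_word -sum1_card [leqLHS]big_mkcond /=; apply: leq_sum => i _.
rewrite inE; case: eqP => //= s0; case: eqP => //= ->.
by rewrite mulr0; case: eqP.
Qed.

(** The distance enumerator of the line spanned by (1, c) seen from the point
(0, s): the term b records the distance from (0, s) to (b, c b). *)
Definition block_poly (s : F) : {poly int} :=
  \sum_(b : F) 'X^((b != 0) + (s != c * b)).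

(** Multiplication by s preserves the line and sends (0, 1) to (0, s). *)
Lemma block_poly_scale s : s != 0 -> block_poly s = block_poly 1.
Proof.
move=> s0; rewrite /block_poly (reindex_inj (mulfI s0)).
apply: eq_bigr => b _; rewrite mulf_eq0 (negPf s0) /=; congr ('X^(_ + ~~ _)).
by rewrite mulrCA -subr_eq0 -{1}(mulr1 s) -mulrBr mulf_eq0 (negPf s0) subr_eq0.
Qed.

(** The distance is additive over blocks, so expanding the product over all
choices of one point per block gives the sum. *)
Lemma dist_poly_prod v :
  \sum_a 'X^(hdist v (word a)) =
  \prod_i block_poly (syndrome v i) :> {poly int}.
Proof.
have -> : \prod_i block_poly (syndrome v i) =
    \prod_i \sum_(b : F) 'X^(((b - v 0 (f (i, ord0)))%R != 0%R) +
           (syndrome v i != c * (b - v 0 (f (i, ord0))))%R) :> {poly int}.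
  apply: eq_bigr => i _; rewrite /block_poly.
  by rewrite (reindex_inj (addIr (- v 0 (f (i, ord0))))).
rewrite bigA_distr_bigA; apply: eq_bigr => a _.
by rewrite hdist_word; elim/big_rec2: _ => // i x y _ <-; rewrite exprD.
Qed.

Lemma Bnum_coef v t :
  (Bnum C v t)%:R = (\sum_a 'X^(hdist v (word a)) : {poly int})`_t.
Proof.
have -> : Bnum C v t = #|[set a | hdist v (word a) == t]|.
  rewrite -(card_imset _ word_inj); apply: eq_card => x; rewrite inE.
  apply/andP/imsetP => [[/in_word xE /eqP xt] | [a + ->]].
    by exists [ffun i => x 0 (f (i, ord0))]; rewrite ?inE -?xE ?xt.
  by rewrite inE word_in.
rewrite coef_sum -sum1dep_card big_mkcond natr_sum; apply: eq_bigr => a _.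
by rewrite coefXn eq_sym; case: eqP.
Qed.

(** By [block_poly_scale] the enumerator of v only depends on the number of
nonzero syndromes, which is the distance to C. *)
Lemma completely_regular_blocks : completely_regular C.
Proof.
move=> v u t _; rewrite !dist_code_syndrome => e.
apply/eqP; rewrite -(Num.Theory.eqr_nat int) !Bnum_coef !dist_poly_prod.
apply/eqP.
suff prodE w : \prod_i block_poly (syndrome w i) =
    block_poly 1 ^+ #|[pred i | syndrome w i != 0]| *
    block_poly 0 ^+ (j - #|[pred i | syndrome w i != 0]|).
  by rewrite !prodE e.
rewrite (bigID [pred i | syndrome w i != 0]) /=; congr (_ * _).
  rewrite -prodr_const; apply: eq_big => [i | i s0]; first by rewrite inE.
  exact: block_poly_scale.
rewrite -[X in _ ^+ (X - _)](card_ord j) -(cardC [pred i | syndrome w i != 0]).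
rewrite addKn -prodr_const.
by apply: eq_big => i; rewrite ?inE // negbK => /eqP ->.
Qed.

End Regularity.

(** * Existence and classification *)

Section Existence.
Local Open Scope ring_scope.

Lemma wt_pair_word (F : finFieldType) n (i j : 'I_n) (c : F) :
  (hdist (pair_word i j c) 0 <= 2)%N.
Proof.
apply: leq_trans (_ : #|[set i; j]| <= 2)%N; last by rewrite cards2; case: eqP.
apply/subset_leq_card/subsetP => k; rewrite !inE pair_wordE mxE.
apply: contraR; rewrite negb_or => /andP[/negPf-> /negPf->].
by rewrite mulr0 addr0.
Qed.

(** The coordinates are indexed by pairs (block, position), enumerated in any
order, and the code is the kernel of all the syndromes. *)
Lemma exists_sum_of_212 (F : finFieldType) (c : F) j :
  c ^+ 2 = -1 -> (0 < j)%N ->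
  exists n k d (C : {vspace 'rV[F]_n}),
    [/\ is_code k d C, self_dual C, completely_regular C, (d <= 2)%N &
        sum_of_212 j C].
Proof.
move=> c2 j0; pose n := #|{: 'I_j * 'I_2}|.
pose f : 'I_j * 'I_2 -> 'I_n := enum_rank.
pose g : 'I_n -> 'I_j * 'I_2 := enum_val.
have fK : cancel f g by exact: enum_rankK.
have gK : cancel g f by exact: enum_valK.
pose proj b :=
  linfun (colsub (fun i : 'I_j => f (i, b)) : 'rV[F]_n -> 'rV[F]_j).
pose C := lker (proj ord_max - c *: proj ord0).
have projE b x i : proj b x 0 i = x 0 (f (i, b)) by rewrite lfunE /= mxE.
have CP x : x \in C <-> paired f (fun=> c) x.
  rewrite memv_ker add_lfunE opp_lfunE scale_lfunE subr_eq0.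
  split=> [/eqP/rowP e i | px].
    by have := e i; rewrite [RHS]mxE !projE.
  by apply/eqP/rowP => i; rewrite [RHS]mxE !projE px.
have c2' (i : 'I_j) : c ^+ 2 = -1 by [].
have f_bij := Bijective fK gK.
have nE := length_blocks f_bij.
have dimC : (\dim C <= j)%N.
  by apply: (dim_paired f_bij (c := fun=> c)) => x /CP.
pose i0 := Ordinal j0.
have wC := paired_pair_word f_bij (fun=> c) i0; move/CP: wC => wC.
have w0 : pair_word (f (i0, ord0)) (f (i0, ord_max)) c != 0.
  apply/eqP => /rowP/(_ (f (i0, ord0))); rewrite pair_wordE mxE eqxx.
  rewrite (bij_eq f_bij) xpair_eqE andbF mulr0 addr0.
  by move/eqP; rewrite oner_eq0.
have dimC0 : (0 < \dim C)%N.
  rewrite lt0n dimv_eq0; apply: contra_neq w0 => C0.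
  by apply/eqP; rewrite -memv0 -C0.
exists n, (\dim C), (min_dist C), C; split.
- split=> //; rewrite dimC0; apply: leq_ltn_trans dimC _.
  by rewrite [ltnRHS]nE ltn_Pmulr.
- exact: (paired_self_dual f_bij c2' CP).
- exact: (completely_regular_blocks fK gK CP).
- exact: leq_trans (min_dist_le_wt wC w0) (wt_pair_word _ _ _).
- exact: (paired_sum_of_212 f_bij c2' CP).
Qed.

End Existence.

Theorem theorem15 (q : nat) (F : finFieldType) (hq : #|F| = q) :
  (forall (n k d : nat) (C : {vspace 'rV[F]_n}),
     is_code k d C -> self_dual C -> completely_regular C -> d <= 2 ->
     [/\ n = 2, k = 1, d = 2 & is_mds C] \/
     (exists j : nat, [/\ 1 < j, sum_of_212 j C & ~ is_mds C])) /\
  ((exists (n k d : nat) (C : {vspace 'rV[F]_n}),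
      [/\ is_code k d C, self_dual C, completely_regular C & d <= 2]) <->
   (~~ odd q \/ q = 1 %[mod 4])) /\
  (forall j : nat, 0 < j ->
     ((exists (n k d : nat) (C : {vspace 'rV[F]_n}),
         [/\ is_code k d C, self_dual C, completely_regular C, d <= 2 &
             sum_of_212 j C]) <->
      (~~ odd q \/ q = 1 %[mod 4]))).
Proof.
have classify (n k d : nat) (C : {vspace 'rV[F]_n}) :
    is_code k d C -> self_dual C -> completely_regular C -> d <= 2 ->
    exists j (f : 'I_j * 'I_2 -> 'I_n) (c : 'I_j -> F),
    [/\ bijective f, forall i, (c i ^+ 2 = -1)%R,
        forall x, x \in C <-> paired f c x & 0 < j].
  move=> [/andP[k0 kn] dimC dC] sd cr d2.
  have [||j [f [c [f_bij c2 CP]]]] := block_structure sd cr.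
  - by rewrite dimC.
  - by rewrite dC.
  exists j, f, c; split=> //.
  by have := length_blocks f_bij; lia.
have necessary (n k d : nat) (C : {vspace 'rV[F]_n}) :
    is_code k d C -> self_dual C -> completely_regular C -> d <= 2 ->
    ~~ odd q \/ q = 1 %[mod 4].
  move=> CC sd cr d2.
  have [j [f [c [_ c2 _ j0]]]] := classify _ _ _ _ CC sd cr d2.
  by rewrite -hq; exact: card_of_sqrtN1 (c2 (Ordinal j0)).
have sufficient j : 0 < j -> ~~ odd q \/ q = 1 %[mod 4] ->
    exists (n k d : nat) (C : {vspace 'rV[F]_n}),
      [/\ is_code k d C, self_dual C, completely_regular C, d <= 2 &
          sum_of_212 j C].
  move=> j0; rewrite -hq => /sqrtN1_of_card[c c2].
  exact: exists_sum_of_212 c2 j0.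
split; [|split] => [n k d C CC sd cr d2||j j0].
- have [j [f [c [f_bij c2 CP j0]]]] := classify _ _ _ _ CC sd cr d2.
  have nE := length_blocks f_bij; have [/andP[k0 kn] dimC dC] := CC.
  have [j1 | j1] := leqP j 1; last first.
    right; exists j; split=> //; first exact: (paired_sum_of_212 f_bij c2 CP).
    by apply: (paired_not_mds f_bij (c := c) _ _ j1) => [x /CP|]; rewrite ?dC.
  have n2 : n = 2 by lia.
  have k1 : k = 1 by lia.
  have d_eq2 : d = 2.
    apply/eqP; rewrite eqn_leq d2 -dC /=; apply: min_dist_ge2 => [|x xC].
      exact: leq_ltn_trans kn.
    exact: (self_dual_orth sd xC xC).
  by left; split=> //; rewrite /is_mds dC dimC d_eq2 k1 n2.
- split=> [[n [k [d [C [CC sd cr d2]]]]] | qP].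
    exact: necessary CC sd cr d2.
  have [n [k [d [C [CC sd cr d2 _]]]]] := sufficient 1 isT qP.
  by exists n, k, d, C.
- split=> [[n [k [d [C [CC sd cr d2 _]]]]] | qP].
    exact: necessary CC sd cr d2.
  exact: sufficient.
Qed.
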